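(* Let $G\le\mathrm{ASP}$ be a subgroup that is closed under $\triangleleft$. For any $\ell\geq 1$ and any $\alpha_1,\dots,\alpha_\ell,\gamma\in G$, if $\alpha_1\star\cdots\star\alpha_\ell\ge_\chi\gamma$, then there exists a reduced tuple $(\beta_1,\dots,\beta_\ell)$ such that $\beta_i\in G$ and $\beta_i\le_\chi\alpha_i$ for all $i$, and $$\beta_1\star\cdots\star\beta_\ell=\beta_1\cdots\beta_\ell=\gamma.$$
   Context: A permutation means a bijection $\mathbb{Z}\to\mathbb{Z}$; products of permutations are compositions. $\mathrm{ASP}$ is the group of permutations $\alpha$ for which only finitely many $n\in\mathbb{Z}$ have exactly one of $n,\alpha(n)$ negative. For $\alpha\in\mathrm{ASP}$, $s_\alpha(a,b)=\#\{n\ge b:\ \alpha(n)<a\}$ for $a,b\in\mathbb{Z}$ (always finite; $s_\alpha$ determines $\alpha$). The shift of $\alpha$ is $\chi_\alpha=s_\alpha(0,0)-s_{\alpha^{-1}}(0,0)$. Bruhat order on $\mathrm{ASP}$: $\alpha\le\beta$ means $s_\alpha(a,b)\le s_\beta(a,b)$ for all $a,b\in\mathbb{Z}$. Write $\alpha\le_\chi\beta$ (equivalently $\beta\ge_\chi\alpha$) if $\alpha\le\beta$ and $\chi_\alpha=\chi_\beta$. The operations $\star$ (which is associative) and $\triangleleft$ on $\mathrm{ASP}$ are well defined and uniquely characterized by $s_{\alpha\star\beta}(a,b)=\min_{\ell\in\mathbb{Z}}[s_\alpha(a,\ell)+s_\beta(\ell,b)]$ and $s_{\alpha\triangleleft\beta}(a,b)=\max_{\ell\in\mathbb{Z}}[s_\alpha(a,\ell)-s_{\beta^{-1}}(b,\ell)]$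 for all $a,b\in\mathbb{Z}$. For a permutation $\alpha$, $\mathrm{Inv}(\alpha)=\{(u,v)\in\mathbb{Z}^2:\ u<v,\ \alpha(u)>\alpha(v)\}$. A tuple $(\beta_1,\dots,\beta_\ell)$ of elements of $\mathrm{ASP}$ is reduced if, writing $\pi_n=\beta_{n+1}\cdots\beta_\ell$ (with $\pi_\ell$ the identity), one has $\mathrm{Inv}(\beta_n)\cap\mathrm{Inv}(\pi_n^{-1})=\emptyset$ for each $1\le n\le\ell$. (Equivalently: for all $u\ne v$ in $\mathbb{Z}$, the sign of $\pi_n(u)-\pi_n(v)$ changes at most once as $n$ decreases from $\ell$ to $0$.) *)

(* Defs.v *)
From HB Require Import structures.
From mathcomp Require Import all_boot all_order all_algebra.
From mathcomp Require Import finmap boolp classical_sets cardinality.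
From mathcomp Require Import zify.

Set Implicit Arguments.
Unset Strict Implicit.
Unset Printing Implicit Defensive.

Import Order.TTheory GRing.Theory Num.Theory.
Local Open Scope classical_set_scope.
Local Open Scope ring_scope.

(* A bijection of Z is stored together with its two-sided inverse; by ASP_eq
   below equality in ASP is pointwise equality of the underlying functions. *)
Record ASP := MkASP {
  asp_fun :> int -> int;
  asp_inv : int -> int;
  asp_funK : cancel asp_fun asp_inv;
  asp_invK : cancel asp_inv asp_fun;
  asp_fin : finite_set [set n : int | (n < 0) != (asp_fun n < 0)] }.

Lemma ASP_eq (alpha beta : ASP) : alpha =1 beta -> alpha = beta.
Proof.
case: alpha beta => [f f' fK f'K ff] [g g' gK g'K gf] /= /funext fg.
subst g; have fg' : f' = g' by apply/funext => x; rewrite -[x in LHS]g'K fK.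
by subst g'; congr MkASP; apply: Prop_irrelevance.
Qed.

HB.instance Definition _ := gen_eqMixin ASP.
HB.instance Definition _ := gen_choiceMixin ASP.

Lemma asp1_fin : finite_set [set n : int | (n < 0) != (id n < 0)].
Proof. by apply: (@sub_finite_set _ _ set0) => // n /=; rewrite eqxx. Qed.

Definition asp1 : ASP := MkASP (fun=> erefl) (fun=> erefl) asp1_fin.

Lemma aspV_fin (alpha : ASP) :
  finite_set [set n : int | (n < 0) != (asp_inv alpha n < 0)].
Proof.
apply: sub_finite_set (finite_image alpha (asp_fin alpha)) => n /= hn.
by exists (asp_inv alpha n); rewrite /= asp_invK // eq_sym.
Qed.

Definition aspV (alpha : ASP) : ASP :=
  MkASP (asp_invK alpha) (asp_funK alpha) (aspV_fin alpha).

Lemma aspM_fin (alpha beta : ASP) :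
  finite_set [set n : int | (n < 0) != ((alpha \o beta) n < 0)].
Proof.
have fin2 : finite_set [set n : int | (beta n < 0) != (alpha (beta n) < 0)].
  apply: sub_finite_set (finite_image (asp_inv beta) (asp_fin alpha)) => n /= hn.
  by exists (beta n); rewrite /= ?asp_funK.
apply: (@sub_finite_set _ _ (_ `|` _)); last first.
  by rewrite finite_setU; split; [exact: (asp_fin beta) | exact: fin2].
move=> n /=; case: (n < 0) (beta n < 0) (alpha (beta n) < 0) => -[] [] //=;
  by [left | right].
Qed.

Definition aspM (alpha beta : ASP) : ASP :=
  MkASP (can_comp (asp_funK alpha) (asp_funK beta))
    (can_comp (asp_invK beta) (asp_invK alpha)) (aspM_fin alpha beta).

Lemma aspMA : associative aspM. Proof. by move=> ? ? ?; apply: ASP_eq. Qed.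
Lemma asp1M : left_id asp1 aspM. Proof. by move=> ?; apply: ASP_eq. Qed.
Lemma aspM1 : right_id asp1 aspM. Proof. by move=> ?; apply: ASP_eq. Qed.
Lemma aspVM : left_inverse asp1 aspV aspM.
Proof. by move=> a; apply: ASP_eq => x; exact: asp_funK. Qed.
Lemma aspMV : right_inverse asp1 aspV aspM.
Proof. by move=> a; apply: ASP_eq => x; exact: asp_invK. Qed.

(* Products are compositions: (alpha * beta)%g n = alpha (beta n). *)
HB.instance Definition _ := isGroup.Build ASP aspMA asp1M aspM1 aspVM aspMV.

Definition s_set (alpha : ASP) (a b : int) : set int :=
  [set n | b <= n /\ alpha n < a].

Lemma int_itv_fin (a b : int) : finite_set [set n : int | a <= n /\ n < b].
Proof.
apply: sub_finite_set (finite_image (fun k : nat => a + k%:Z)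
  (finite_II `|b - a|%N)) => n /= [h1 h2].
by exists `|n - a|%N => /=; lia.
Qed.

Lemma s_set_fin (alpha : ASP) (a b : int) : finite_set (s_set alpha a b).
Proof.
apply: (@sub_finite_set _ _ ([set n : int | b <= n /\ n < 0] `|`
  ([set n : int | (n < 0) != (alpha n < 0)] `|`
   asp_inv alpha @` [set n : int | 0 <= n /\ n < a])));
  last first.
  rewrite !finite_setU; split; [exact: int_itv_fin | split].
    exact: (asp_fin alpha).
  by apply: finite_image; exact: int_itv_fin.
move=> n /= [bn na]; case: (ltP n 0) => n0; first by left.
case: (ltP (alpha n) 0) => an0; first by right; left.
by right; right; exists (alpha n); rewrite ?asp_funK.
Qed.

Definition s (alpha : ASP) (a b : int) : nat := #|` fset_set (s_set alpha a b)|.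

Lemma s_succ (alpha : ASP) (a b : int) :
  s alpha (a + 1) b = (s alpha a b + (b <= (alpha^-1)%g a)%R)%N.
Proof.
have valV : alpha ((alpha^-1)%g a) = a by exact: asp_invK.
have Vval n : alpha n = a -> n = (alpha^-1)%g a.
  by move=> <-; symmetry; exact: asp_funK.
rewrite /s; case: leP => h; last first.
  rewrite addn0; congr (#|` fset_set _|); apply/seteqP.
  split=> n /= [bn an]; split => //; last by lia.
  by case: (eqVneq (alpha n) a) => [/Vval nE|]; lia.
have -> : s_set alpha (a + 1) b = (alpha^-1)%g a |` s_set alpha a b.
  apply/seteqP; split=> n /=.
    move=> [bn an]; case: (eqVneq (alpha n) a) => [/Vval|]; first by left.
    by move=> an'; right; split => //; lia.
  by move=> [->|[bn an]]; split => //; rewrite ?valV; lia.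
rewrite fset_setU1; last exact: s_set_fin.
rewrite cardfsU1 in_fset_set; last exact: s_set_fin.
have -> : ((alpha^-1)%g a \in s_set alpha a b) = false.
  by apply/negbTE/negP => /set_mem [_]; rewrite valV ltxx.
by rewrite addnC.
Qed.

Lemma s_inj (alpha beta : ASP) :
  (forall a b, s alpha a b = s beta a b) -> alpha = beta.
Proof.
move=> sE; apply: (can_inj invgK); apply: ASP_eq => a.
have h b : (b <= (alpha^-1)%g a) = (b <= (beta^-1)%g a).
  have := s_succ alpha a b; rewrite !sE s_succ => /addnI.
  by case: (b <= _); case: (b <= _).
by apply/eqP; rewrite eq_le h lexx -h lexx.
Qed.

Definition chi (alpha : ASP) : int := (s alpha 0 0)%:Z - (s alpha^-1%g 0 0)%:Z.

Definition bruhat_le (alpha beta : ASP) : Prop :=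
  forall a b : int, (s alpha a b <= s beta a b)%N.

Definition le_chi (alpha beta : ASP) : Prop :=
  bruhat_le alpha beta /\ chi alpha = chi beta.

Definition is_star (alpha beta gamma : ASP) : Prop :=
  forall a b : int,
    (exists l, s gamma a b = (s alpha a l + s beta l b)%N) /\
    (forall l, (s gamma a b <= s alpha a l + s beta l b)%N).

Definition is_tri (alpha beta gamma : ASP) : Prop :=
  forall a b : int,
    (exists l, (s gamma a b)%:Z = (s alpha a l)%:Z - (s beta^-1%g b l)%:Z) /\
    (forall l, (s alpha a l)%:Z - (s beta^-1%g b l)%:Z <= (s gamma a b)%:Z).

Lemma is_star_uniq alpha beta gamma gamma' :
  is_star alpha beta gamma -> is_star alpha beta gamma' -> gamma = gamma'.
Proof.
move=> h h'; apply: s_inj => a b.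
case: (h a b) (h' a b) => -[l hl] hm [[l' hl'] hm'].
by apply/eqP; rewrite eqn_leq {2}hl hm' {1}hl' hm.
Qed.

Lemma is_tri_uniq alpha beta gamma gamma' :
  is_tri alpha beta gamma -> is_tri alpha beta gamma' -> gamma = gamma'.
Proof.
move=> h h'; apply: s_inj => a b.
case: (h a b) (h' a b) => -[l hl] hm [[l' hl'] hm'].
have := hm l'; have := hm' l; lia.
Qed.

(* The default value 1 is never used: for all alpha and beta there is exactly
   one gamma satisfying is_star (resp. is_tri). *)
Definition star (alpha beta : ASP) : ASP := xget 1%g (is_star alpha beta).

Definition tri (alpha beta : ASP) : ASP := xget 1%g (is_tri alpha beta).

(* (... (a1 star a2) star ...) star al *)
Definition star_prod (t : seq ASP) : ASP :=
  if t is a :: t' then foldl star a t' else 1%g.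

Definition Inv (alpha : ASP) : set (int * int) :=
  [set p | p.1 < p.2 /\ alpha p.2 < alpha p.1].

(* With the 0-based indexing of sequences, the entry nth 1 t n is beta_(n+1)
   and the product over drop n.+1 t is pi_(n+1). *)
Definition reduced (t : seq ASP) : Prop :=
  forall n, (n < size t)%N ->
    Inv (nth 1%g t n) `&` Inv ((\prod_(b <- drop n.+1 t) b)^-1)%g = set0.

(* Main.v *)
Require Import Defs.
From mathcomp Require Import all_boot all_order all_algebra.
From mathcomp Require Import finmap boolp classical_sets cardinality.
From mathcomp Require Import zify.

Set Implicit Arguments.
Unset Strict Implicit.
Unset Printing Implicit Defensive.

Import Order.TTheory GRing.Theory Num.Theory.
Local Open Scope classical_set_scope.
Local Open Scope ring_scope.

(** The operation [tri] is the residual of [star]: unfolding the minimum and the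
maximum, [gamma <= star alpha beta] and [tri gamma beta^-1 <= alpha] both say
that [s gamma a b <= s alpha a l + s beta l b] for all [a], [l], [b]. So for two
factors the candidate is [delta := tri gamma beta^-1], which stays in [G] and is
below [alpha], together with [delta^-1 * gamma], whose product with [delta] is
[gamma] by construction. Two points remain.

The pair is reduced: [delta] lies below [gamma] in the weak order, that is,
[Inv delta^-1] is contained in [Inv gamma^-1] ([is_tri_weak]). This is an
exchange argument on the maximizers defining [tri], based on the Monge
inequality [s_monge].

The second factor is below [beta]: for a reduced product [delta * eps], the
counting bound [s (delta * eps) a b <= s delta a l + s eps l b] is an equality
for a suitable [l] once [a], [b] are given ([is_star_reduced]), and also for a
suitable [a] once [l], [b] are given ([reduced_attained]). The former says that
[star delta eps = delta * eps]. The latter recovers [s eps l b] as the maximum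
over [a] of [s gamma a b - s delta a l], and each of these differences is at most
[s beta l b] by the definition of [delta].

For longer tuples one splits off the last factor and applies the induction
hypothesis to [delta] ([tuple_factor]); reducedness of the extended tuple is
[reduced_rcons]. No associativity is involved, since the iterated product is
bracketed to the left.

To use the min-plus and max-plus formulas one must know that the two operations
exist. A function of two integers is some [s alpha] as soon as it satisfies the
Monge inequality and has the right values far away in each direction
([rank_table_realized]), and both conditions pass to the minimum and to the
maximum ([is_star_ex], [is_tri_ex]). The shift is additive because it can be read
off from the far values. *)

(** * Integers *)

Lemma int_const (T : Type) (f : int -> T) :
  (forall n : int, f (n + 1) = f n) -> forall m n, f m = f n.
Proof.
move=> fS; suff f0 n : f n = f 0 by move=> m n; rewrite !f0.
elim/int_ind: n => [//|n <-|n <-]; first by rewrite -[in RHS]fS; congr f; lia.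
by rewrite -[in LHS]fS; congr f; lia.
Qed.

Lemma int_least (P : int -> Prop) (m : int) :
    (exists n, P n) -> (forall n, P n -> m <= n) ->
  exists2 n, P n & forall n', P n' -> n <= n'.
Proof.
move=> [n0 Pn0] lb.
have exP : exists k : nat, `[< P (m + k%:Z) >].
  by exists `|n0 - m|%N; apply/asboolP; have := lb _ Pn0 => ?;
    rewrite (_ : m + _ = n0) //; lia.
case: (ex_minnP exP) => k /asboolP Pk mink; exists (m + k%:Z) => // n Pn.
have := lb _ Pn => ?; suff : (k <= `|n - m|)%N by lia.
by apply: mink; apply/asboolP; rewrite (_ : m + _ = n) //; lia.
Qed.

Lemma int_argmax (f : int -> int) (M : int) :
  (forall n, f n <= M) -> exists n, forall n', f n' <= f n.
Proof.
move=> fM; case: (@int_least (fun k => exists n, k = - f n) (- M)).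
- by exists (- f 0), 0.
- by move=> _ [n ->]; have := fM n; lia.
move=> _ [n ->] minn; exists n => n'.
by have := minn _ (ex_intro _ n' erefl); lia.
Qed.

(** Either set may be empty, hence the separate bounds [u] and [v]. *)
Lemma int_separate (Q P : int -> Prop) (u v : int) :
    (forall q, Q q -> q < u) -> (forall p, P p -> v <= p) ->
    (forall q p, Q q -> P p -> q < p) ->
  exists l, (forall q, Q q -> q < l) /\ (forall p, P p -> l <= p).
Proof.
move=> Qu Pv QP; have [exP|nexP] := pselect (exists p, P p).
  by have [p Pp minp] := int_least exP Pv; exists p; split=> // q /QP; apply.
by exists u; split=> // p Pp; case: nexP; exists p.
Qed.

Lemma finite_int_bounded (A : set int) :
  finite_set A -> exists l u : int, forall n, A n -> l <= n /\ n < u.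
Proof.
move=> /finite_seqP[r ->]; elim: r => [|x r [l [u IH]]]; first by exists 0, 0.
exists (Order.min l x), (Order.max u (x + 1)) => n /=.
by rewrite in_cons => /orP[/eqP->|/IH]; lia.
Qed.

(** * Rank functions *)

Lemma aspVK (alpha : ASP) x : (alpha^-1)%g (alpha x) = x.
Proof. exact: asp_funK. Qed.

Lemma aspKV (alpha : ASP) x : alpha ((alpha^-1)%g x) = x.
Proof. exact: asp_invK. Qed.

Lemma asp_inj (alpha : ASP) : injective alpha.
Proof. exact: can_inj (aspVK alpha). Qed.

Lemma s_pred (alpha : ASP) a b :
  s alpha a b = (s alpha a (b + 1) + (alpha b < a)%R)%N.
Proof.
rewrite /s; case: ltP => h; last first.
  rewrite addn0; congr (#|` fset_set _|); apply/seteqP.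
  split=> n /= [bn an]; split => //; last by lia.
  by case: (eqVneq n b) => [nE|]; [move: an; rewrite nE|]; lia.
have -> : s_set alpha a b = b |` s_set alpha a (b + 1).
  apply/seteqP; split=> n /=.
    by move=> [bn an]; case: (eqVneq n b) => [|?]; [left|right; split; lia].
  by move=> [->|[bn an]]; split => //; lia.
rewrite fset_setU1; last exact: s_set_fin.
rewrite cardfsU1 in_fset_set; last exact: s_set_fin.
have -> : (b \in s_set alpha a (b + 1)) = false.
  by apply/negbTE/negP => /set_mem [] /=; lia.
by rewrite addnC.
Qed.

(** The difference of the two sides does not change when [a] or [b] grows by one.
Through this symmetry every statement on where [s] vanishes becomes one on where
[s] equals its other asymptotic value [a - b + chi alpha]. *)
Lemma s_dual (alpha : ASP) a b :
  (s alpha a b)%:Z = (s alpha^-1%g b a)%:Z + (a - b) + chi alpha.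
Proof.
pose D a b := (s alpha a b)%:Z - (s alpha^-1%g b a)%:Z - (a - b).
suff : D a b = D 0 0 by rewrite /D /chi; lia.
have -> : D a b = D 0 b.
  apply: (@int_const _ (D ^~ b)) => {}a; rewrite /D s_succ.
  by rewrite [s _ b a]s_pred; lia.
apply: (@int_const _ (D 0)) => {}b; rewrite /D s_succ invgK.
by rewrite [s _ 0 b]s_pred; lia.
Qed.

(** Each unit step in [a] adds the indicator of [b <= alpha^-1 a], which is
nonincreasing in [b]. *)
Lemma s_monge (alpha : ASP) a a' b b' : a <= a' -> b <= b' ->
  (s alpha a b + s alpha a' b' <= s alpha a' b + s alpha a b')%N.
Proof.
move=> aa' bb'; rewrite (_ : a' = a + `|a' - a|%N%:Z); last by lia.
elim: `|_|%N => [|k]; first by rewrite addr0 addnC.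
by rewrite (_ : a + k.+1%:Z = a + k%:Z + 1) ?s_succ; lia.
Qed.

Lemma s_homo (alpha : ASP) a a' b : a <= a' -> (s alpha a b <= s alpha a' b)%N.
Proof.
move=> aa'; rewrite (_ : a' = a + `|a' - a|%N%:Z); last by lia.
elim: `|_|%N => [|k]; first by rewrite addr0.
by rewrite (_ : a + k.+1%:Z = a + k%:Z + 1) ?s_succ; lia.
Qed.

Lemma s_anti (alpha : ASP) a b b' : b <= b' ->
  (s alpha a b' <= s alpha a b)%N.
Proof.
move=> bb'; rewrite (_ : b' = b + `|b' - b|%N%:Z); last by lia.
elim: `|_|%N => [|k]; first by rewrite addr0.
rewrite (_ : b + k.+1%:Z = b + k%:Z + 1); last by lia.
by rewrite (s_pred _ a (b + k%:Z)); lia.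
Qed.

Lemma s_lipschitz (alpha : ASP) a b b' : b <= b' ->
  (s alpha a b)%:Z <= (s alpha a b')%:Z + (b' - b).
Proof.
by move=> /(@s_homo alpha^-1%g _ _ a); rewrite !(s_dual alpha); lia.
Qed.

Lemma s_eq0P (alpha : ASP) a b :
  s alpha a b = 0%N <-> (forall n, b <= n -> a <= alpha n).
Proof.
rewrite /s; split=> [/eqP|h].
  rewrite cardfs_eq0 => /eqP s0 n bn.
  have /seteqP[/(_ n) h _] := fset_set_set0 (@s_set_fin _ _ _) s0.
  by rewrite leNgt; apply/negP => ?; apply: h.
rewrite (_ : s_set _ _ _ = set0) ?fset_set0 ?cardfs0 //.
by apply/seteqP; split=> // n [/h]; lia.
Qed.

Lemma s_vanish_b (alpha : ASP) a :
  exists N, forall b, N <= b -> s alpha a b = 0%N.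
Proof.
have [l [u lu]] := finite_int_bounded (s_set_fin alpha a 0).
exists (Order.max 0 u) => b ub; apply/s_eq0P => n bn.
case: (leP a (alpha n)) => // an.
by have [|? ?] := lu n; [split => // |]; lia.
Qed.

Lemma s_vanish_a (alpha : ASP) b :
  exists N, forall a, a <= N -> s alpha a b = 0%N.
Proof.
have [l [u lu]] := finite_int_bounded (finite_image alpha (s_set_fin alpha 0 b)).
exists (Order.min 0 l) => a al; apply/s_eq0P => n bn.
case: (leP a (alpha n)) => // an; have [|? ?] := lu (alpha n); last lia.
by exists n => //; split => //; lia.
Qed.

Lemma s_full_a (alpha : ASP) b :
  exists N, forall a, N <= a -> (s alpha a b)%:Z = a - b + chi alpha.
Proof.
by have [N hN] := s_vanish_b alpha^-1%g b; exists N => a /hN; rewrite s_dual; lia.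
Qed.

Lemma s_full_b (alpha : ASP) a :
  exists N, forall b, b <= N -> (s alpha a b)%:Z = a - b + chi alpha.
Proof.
by have [N hN] := s_vanish_a alpha^-1%g a; exists N => b /hN; rewrite s_dual; lia.
Qed.

Lemma s_ge (alpha : ASP) a b : a - b + chi alpha <= (s alpha a b)%:Z.
Proof. by rewrite s_dual; lia. Qed.

(** * Permutations from their rank tables *)

(** These conditions, satisfied by [s alpha] with [c = chi alpha], make [S] the
rank function of a permutation: the mixed second difference of [S] is then its
permutation matrix. *)
Record rank_table (c : int) (S : int -> int -> int) : Prop := RankTable {
  table_monge : forall a b,
    S a b + S (a + 1) (b + 1) <= S (a + 1) b + S a (b + 1);
  table_vanish_a : forall b, exists N, forall a, a <= N -> S a b = 0;
  table_vanish_b : forall a, exists N, forall b, N <= b -> S a b = 0;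
  table_full_a : forall b, exists N, forall a, N <= a -> S a b = a - b + c;
  table_full_b : forall a, exists N, forall b, b <= N -> S a b = a - b + c }.

(** The counterpart of [s_dual]: it yields the candidate for the inverse
permutation from the same construction as the permutation itself. *)
Lemma rank_table_dual c S :
  rank_table c S -> rank_table (- c) (fun b a => S a b - (a - b) - c).
Proof.
move=> [mon va vb fa fb]; split.
- by move=> b a; have := mon a b; lia.
- by move=> a; have [N hN] := fb a; exists N => b /hN->; lia.
- by move=> b; have [N hN] := fa b; exists N => a /hN->; lia.
- by move=> a; have [N hN] := vb a; exists N => b /hN->; lia.
by move=> b; have [N hN] := va b; exists N => a /hN->; lia.
Qed.

(** By the Monge condition the difference of two neighbouring columns is
nondecreasing in [a]; it is 0 far to the left and 1 far to the right, so it jumps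
exactly once, at the value of the permutation. *)
Lemma rank_table_jump c S : rank_table c S ->
  exists f : int -> int, forall b a, S a b - S a (b + 1) = (f b < a)%R%:Z.
Proof.
move=> [mon va vb fa fb].
suff /choice[f fP] : forall b, exists m,
    forall a, S a b - S a (b + 1) = (m < a)%R%:Z by exists f.
move=> b; pose d a := S a b - S a (b + 1).
have d_homo a a' : a <= a' -> d a <= d a'.
  move=> aa'; rewrite (_ : a' = a + `|a' - a|%N%:Z); last by lia.
  elim: `|_|%N => [|k]; first by rewrite addr0.
  rewrite (_ : a + k.+1%:Z = a + k%:Z + 1); last by lia.
  by have := mon (a + k%:Z) b; rewrite /d; lia.
have [[N0 v0] [N1 v1]] := (va b, va (b + 1)).
have [[M0 f0] [M1 f1]] := (fa b, fa (b + 1)).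
have d_lo a : a <= Order.min N0 N1 -> d a = 0.
  by move=> aN; rewrite /d v0 ?v1; lia.
have d_hi a : Order.max M0 M1 <= a -> d a = 1.
  by move=> aN; rewrite /d f0 ?f1; lia.
have [||m dm min_m] := @int_least (fun a => 1 <= d a) (Order.min N0 N1).
- by exists (Order.max M0 M1); rewrite d_hi.
- by move=> a da; case: (leP (Order.min N0 N1) a) => // aN; rewrite d_lo in da; lia.
exists (m - 1) => a; rewrite -/(d a).
have d_ge0 : 0 <= d a.
  by rewrite -(d_lo (Order.min a (Order.min N0 N1))) ?d_homo; lia.
have d_le1 : d a <= 1.
  by rewrite -(d_hi (Order.max a (Order.max M0 M1))) ?d_homo; lia.
case: ltP => ma; last by case: (leP 1 (d a)) => [/min_m|]; lia.
by have := d_homo m a; lia.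
Qed.

Lemma rank_table_realized c S : rank_table c S ->
  exists2 alpha : ASP, (forall a b, (s alpha a b)%:Z = S a b) & chi alpha = c.
Proof.
move=> tS; have [f fS] := rank_table_jump tS.
have [g gS] := rank_table_jump (rank_table_dual tS).
have fK : cancel f g.
  move=> b; have := (fS b (f b), fS b (f b + 1), gS (f b) b, gS (f b) (b + 1)).
  by move=> [[[]]]; lia.
have gK : cancel g f.
  move=> a; have := (fS (g a) a, fS (g a) (a + 1), gS a (g a), gS a (g a + 1)).
  by move=> [[[]]]; lia.
have ffin : finite_set [set n : int | (n < 0) != (f n < 0)].
  have [[N vN] [M fM]] := (table_vanish_b tS 0, table_full_b tS 0).
  apply: sub_finite_set (int_itv_fin (Order.min (M - 1) 0) (Order.max N 0)).
  move=> n /= hn; have := fS n 0; case: (ltP n 0) => n0.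
    by case: (leP (M - 1) n) => nM; last (rewrite !fM; [|lia|lia]); lia.
  by case: (ltP n N) => nN; last (rewrite !vN; [|lia|lia]); lia.
pose alpha := MkASP fK gK ffin.
have sE a b : (s alpha a b)%:Z = S a b.
  have [[N vN] [M vM]] := (table_vanish_b tS a, s_vanish_b alpha a).
  pose D b := (s alpha a b)%:Z - S a b.
  suff : D b = 0 by rewrite /D; lia.
  rewrite (@int_const _ D _ b (Order.max N M)); first by rewrite /D vN ?vM; lia.
  by move=> {}b; rewrite /D (s_pred _ a b); have := fS b a; rewrite -[f b]/(alpha b); lia.
exists alpha => //.
have [[N fN] [M hM]] := (table_full_b tS 0, s_full_b alpha 0).
have := fN (Order.min N M); have := hM (Order.min N M).
by rewrite sE; lia.
Qed.

(** * Existence of the two operations *)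

Lemma chiV (alpha : ASP) : chi alpha^-1%g = - chi alpha.
Proof. by rewrite /chi invgK; lia. Qed.

Lemma is_star_ex (alpha beta : ASP) :
  exists2 gamma, is_star alpha beta gamma & chi gamma = chi alpha + chi beta.
Proof.
pose f (a b l : int) : int := (s alpha a l)%:Z + (s beta l b)%:Z.
have [m S_le] : exists m : int -> int -> int,
    forall a b l, f a b (m a b) <= f a b l.
  have /choice[m fm] (ab : int * int) :
      exists l, forall l', f ab.1 ab.2 l <= f ab.1 ab.2 l'.
    case: (@int_argmax (fun l => - f ab.1 ab.2 l) 0) => [l|l hl].
      by rewrite /f; lia.
    by exists l => l'; have := hl l'; lia.
  by exists (fun a b => m (a, b)) => a b; exact: (fm (a, b)).
pose S a b := f a b (m a b).
have {}S_le a b l : S a b <= f a b l by exact: S_le.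
have S_ge0 (a b : int) : 0 <= S a b by [].
have S_ge (a b : int) : a - b + (chi alpha + chi beta) <= S a b.
  by have := s_ge alpha a (m a b); have := s_ge beta (m a b) b;
    rewrite /S /f; lia.
have tS : rank_table (chi alpha + chi beta) S.
  split.
  (* The two minimizers are reused for the other two corners; which of the two
     summands is exchanged depends on the order of the minimizers. *)
  - move=> a b; rewrite {3 4}/S; set l1 := m (a + 1) b; set l2 := m a (b + 1).
    case: (leP l1 l2) => l12.
      have := S_le a b l1; have := S_le (a + 1) (b + 1) l2; rewrite /f.
      by have := @s_monge alpha a (a + 1) _ _ _ l12; lia.
    have := S_le a b l2; have := S_le (a + 1) (b + 1) l1; rewrite /f.
    by have := @s_monge beta _ _ b (b + 1) (ltW l12); lia.
  - move=> b; have [l sl] := s_vanish_a beta b.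
    have [N hN] := s_vanish_a alpha l.
    exists N => a aN; have := S_le a b l; have := S_ge0 a b.
    by rewrite /f hN ?sl //; lia.
  - move=> a; have [l sl] := s_vanish_b alpha a.
    have [N hN] := s_vanish_b beta l.
    exists N => b bN; have := S_le a b l; have := S_ge0 a b.
    by rewrite /f hN ?sl //; lia.
  - move=> b; have [l sl] := s_full_a beta b.
    have [N hN] := s_full_a alpha l.
    exists N => a aN; have := S_le a b l; have := S_ge a b.
    by rewrite /f hN ?sl //; lia.
  move=> a; have [l sl] := s_full_b alpha a.
  have [N hN] := s_full_b beta l.
  exists N => b bN; have := S_le a b l; have := S_ge a b.
  by rewrite /f hN ?sl //; lia.
have [gamma sg chig] := rank_table_realized tS; exists gamma => // a b.
split=> [|l]; last by have := S_le a b l; rewrite -sg /f; lia.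
by exists (m a b); have := sg a b; rewrite /S /f; lia.
Qed.

Lemma starP (alpha beta : ASP) : is_star alpha beta (star alpha beta).
Proof. by apply: xgetPex; have [gamma] := is_star_ex alpha beta; exists gamma. Qed.

Lemma chi_is_star (alpha beta gamma : ASP) :
  is_star alpha beta gamma -> chi gamma = chi alpha + chi beta.
Proof.
by have [gamma' /is_star_uniq h <-] := is_star_ex alpha beta => /h->.
Qed.

Lemma is_tri_ex (alpha beta : ASP) :
  exists2 gamma, is_tri alpha beta gamma & chi gamma = chi alpha + chi beta.
Proof.
have -> : chi beta = - chi beta^-1%g by rewrite chiV opprK.
rewrite /is_tri; move: (beta^-1)%g => {}beta.
pose f (a b l : int) : int := (s alpha a l)%:Z - (s beta b l)%:Z.
pose c := chi alpha - chi beta.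
(* [f a b l] is 0 for large [l] and [a - b + c] for small [l]. Each of these two
   values bounds [f a b] everywhere, provided that at some [N] one of the two rank
   functions vanishes while the other one has its other asymptotic value. *)
have f_vanish (a b N : int) : s alpha a N = 0%N ->
    (s beta b N)%:Z = b - N + chi beta -> forall l, f a b l <= 0.
  move=> sN bN l; rewrite /f; case: (leP N l) => Nl.
    by have := s_anti alpha a Nl; lia.
  have := s_lipschitz alpha a (ltW Nl); have := s_ge beta b l; lia.
have f_full (a b N : int) : (s alpha a N)%:Z = a - N + chi alpha -> s beta b N = 0%N ->
    forall l, f a b l <= a - b + c.
  move=> sN bN l; rewrite /f; have := s_ge beta b N; case: (leP N l) => Nl.
    by have := s_anti alpha a Nl; rewrite /c; lia.
  have := s_lipschitz alpha a (ltW Nl); have := s_ge beta b l; rewrite /c; lia.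
have [m S_ge] : exists m : int -> int -> int,
    forall a b l, f a b l <= f a b (m a b).
  have /choice[m fm] (ab : int * int) :
      exists l, forall l', f ab.1 ab.2 l' <= f ab.1 ab.2 l.
    case: ab => a b /=; have [N vN] := s_vanish_b alpha a.
    apply: (@int_argmax _ (Order.max 0 (N - b - chi beta))) => l; rewrite /f.
    have := s_ge beta b l; case: (leP N l) => [/vN->|/ltW Nl]; first lia.
    by have := s_lipschitz alpha a Nl; rewrite (vN N) ?lexx; lia.
  by exists (fun a b => m (a, b)) => a b; exact: (fm (a, b)).
pose S a b := f a b (m a b).
have {}S_ge a b l : f a b l <= S a b by exact: S_ge.
have S_ge0 (a b : int) : 0 <= S a b.
  have [[N vN] [M vM]] := (s_vanish_b alpha a, s_vanish_b beta b).
  by have := S_ge a b (Order.max N M); rewrite /f vN ?vM; lia.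
have S_gec (a b : int) : a - b + c <= S a b.
  have [[N vN] [M vM]] := (s_full_b alpha a, s_full_b beta b).
  by have := S_ge a b (Order.min N M); rewrite /f vN ?vM /c; lia.
have tS : rank_table c S.
  split.
  - move=> a b; rewrite {1 2}/S; set l1 := m a b; set l2 := m (a + 1) (b + 1).
    case: (leP l1 l2) => l12.
      have := S_ge (a + 1) b l1; have := S_ge a (b + 1) l2; rewrite /f.
      by have := @s_monge alpha a (a + 1) _ _ _ l12; lia.
    have := S_ge (a + 1) b l2; have := S_ge a (b + 1) l1; rewrite /f.
    by have := @s_monge beta b (b + 1) _ _ _ (ltW l12); lia.
  - move=> b; have [l sl] := s_full_b beta b; have [N hN] := s_vanish_a alpha l.
    exists N => a aN; apply/eqP; rewrite eq_le S_ge0 andbT.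
    by apply: (@f_vanish _ _ l); [exact: hN | exact: sl].
  - move=> a; have [l sl] := s_vanish_b alpha a; have [N hN] := s_full_a beta l.
    exists N => b bN; apply/eqP; rewrite eq_le S_ge0 andbT.
    by apply: (@f_vanish _ _ l); [exact: sl | exact: hN].
  - move=> b; have [l sl] := s_vanish_b beta b; have [N hN] := s_full_a alpha l.
    exists N => a aN; apply/eqP; rewrite eq_le S_gec andbT.
    by apply: (@f_full _ _ l); [exact: hN | exact: sl].
  move=> a; have [l sl] := s_full_b alpha a; have [N hN] := s_vanish_a beta l.
  exists N => b bN; apply/eqP; rewrite eq_le S_gec andbT.
  by apply: (@f_full _ _ l); [exact: sl | exact: hN].
have [gamma sg chig] := rank_table_realized tS; exists gamma => // a b.
split=> [|l]; last by have := S_ge a b l; rewrite -sg.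
by exists (m a b); rewrite sg.
Qed.

Lemma triP (alpha beta : ASP) : is_tri alpha beta (tri alpha beta).
Proof. by apply: xgetPex; have [gamma] := is_tri_ex alpha beta; exists gamma. Qed.

Lemma chi_tri (alpha beta : ASP) : chi (tri alpha beta) = chi alpha + chi beta.
Proof.
have [gamma /is_tri_uniq h <-] := is_tri_ex alpha beta.
by rewrite (h _ (triP _ _)).
Qed.

(** * Products and rank functions *)

(** Classify the [n] counted on the left by whether [beta n < l]. In general the two
classes are only contained in the sets counted on the right; the hypotheses make
these containments equalities. *)
Lemma s_mul_split (delta beta : ASP) (a l b : int) :
    (forall n, b <= n -> beta n < l -> delta (beta n) < a) ->
    (forall n, n < b -> l <= beta n -> a <= delta (beta n)) ->
  s (delta * beta)%g a b = (s delta a l + s beta l b)%N.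
Proof.
move=> hb hd; rewrite /s.
have -> : s_set (delta * beta)%g a b =
    ((beta^-1)%g @` s_set delta a l) `|` s_set beta l b.
  apply/seteqP; split=> n /=.
    move=> [bn an]; case: (ltP (beta n) l) => nl; first by right.
    by left; exists (beta n) => //; exact: aspVK.
  move=> [[m [lm ma] <-]|[bn nl]]; last by split => //; exact: hb.
  have mE := aspKV beta m; split; last by rewrite -{1}mE in ma.
  rewrite leNgt; apply/negP => /hd; rewrite mE => /(_ lm); lia.
have fin1 := finite_image (beta^-1)%g (s_set_fin delta a l).
rewrite fset_setU //; last exact: s_set_fin.
rewrite cardfsU (_ : (_ `&` _)%fset = fset0); last first.
  apply/fsetP => n; rewrite inE !in_fset_set //; last exact: s_set_fin.
  rewrite inE; apply/negbTE/andP => -[/set_mem[m [lm _] <-] /set_mem[_ /=]].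
  by rewrite aspKV; lia.
rewrite cardfs0 subn0; congr (_ + _)%N.
rewrite fset_set_image; last exact: s_set_fin.
by rewrite card_imfset //; exact: asp_inj.
Qed.

Lemma s_mul_le (delta beta : ASP) (a l b : int) :
  (s (delta * beta)%g a b <= s delta a l + s beta l b)%N.
Proof.
rewrite /s; have fin1 := finite_image (beta^-1)%g (s_set_fin delta a l).
have sub : s_set (delta * beta)%g a b `<=`
    ((beta^-1)%g @` s_set delta a l) `|` s_set beta l b.
  move=> n [bn an]; case: (ltP (beta n) l) => nl; first by right.
  by left; exists (beta n) => //; exact: aspVK.
move: sub; rewrite fset_set_sub ?finite_setU //; last first.
- by split; last exact: s_set_fin.
- exact: s_set_fin.
move=> /fsubset_leq_card/leq_trans; apply; rewrite fset_setU //; last exact: s_set_fin.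
rewrite cardfsU (leq_trans (leq_subr _ _)) // leq_add2r.
rewrite fset_set_image; last exact: s_set_fin.
by rewrite card_imfset //; exact: asp_inj.
Qed.

(** * Reduced pairs *)

Lemma reduced_pairP (delta beta : ASP) :
  Inv delta `&` Inv (beta^-1)%g = set0 <->
  (forall u v, u < v -> beta v < beta u -> delta (beta v) < delta (beta u)).
Proof.
split=> [inv0 u v uv vu|h].
  rewrite lt_neqAle (inj_eq (@asp_inj _)) lt_eqF //= leNgt; apply/negP => uv'.
  suff : (Inv delta `&` Inv (beta^-1)%g) (beta v, beta u) by rewrite inv0.
  split; split=> //.
  by change ((beta^-1)%g (beta u) < (beta^-1)%g (beta v)); rewrite !aspVK.
apply/seteqP; split=> // -[p q] [[/= pq dqp] [/= _ bqp]].
by have := h _ _ bqp; rewrite !aspKV => /(_ pq); lia.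
Qed.

(** The level [l] has to separate the values [beta n] over [n < b] with image below
[a] from those over [n >= b] with image at least [a]. A pair violating this would
be inverted by [beta] and inverted back by [delta]. *)
Lemma is_star_reduced (delta beta : ASP) :
  Inv delta `&` Inv (beta^-1)%g = set0 -> is_star delta beta (delta * beta)%g.
Proof.
move=> /reduced_pairP red a b; split; last by move=> l; exact: s_mul_le.
pose Q q := exists n, [/\ n < b, delta (beta n) < a & q = beta n].
pose P p := exists n, [/\ b <= n, a <= delta (beta n) & p = beta n].
have [u vu] := s_vanish_b (beta^-1)%g b; have [v vv] := s_vanish_a beta b.
have [_ [n [nb _ ->]]|_ [n [bn _ ->]]|_ _ [n [nb na ->]] [n' [bn' an' ->]]|] :=
    @int_separate Q P u v.
- rewrite ltNge; apply/negP => un.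
  by have /s_eq0P/(_ _ (lexx _)) := vu _ un; rewrite aspVK; lia.
- by have /s_eq0P/(_ _ bn) := vv _ (lexx _).
- case: (ltgtP (beta n) (beta n')) => // [|/asp_inj] nn'; last by lia.
  by have := red n n' (lt_le_trans nb bn') nn'; lia.
move=> l [Ql Pl]; exists l; apply: s_mul_split => n.
  move=> bn nl; rewrite ltNge; apply/negP => an.
  by have := Pl (beta n) (ex_intro _ n (And3 bn an erefl)); lia.
move=> nb ln; rewrite leNgt; apply/negP => na.
by have := Ql (beta n) (ex_intro _ n (And3 nb na erefl)); lia.
Qed.

(** Same argument as for [is_star_reduced], with the separation taking place among
the values of [delta * beta]. *)
Lemma reduced_attained (delta beta : ASP) (l b : int) :
    Inv delta `&` Inv (beta^-1)%g = set0 ->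
  exists a, s (delta * beta)%g a b = (s delta a l + s beta l b)%N.
Proof.
move=> /reduced_pairP red.
pose Q q := exists n, [/\ b <= n, beta n < l & q = delta (beta n)].
pose P p := exists n, [/\ n < b, l <= beta n & p = delta (beta n)].
have [u vu] := s_vanish_b (delta^-1)%g l; have [v vv] := s_vanish_a delta l.
have [_ [n [_ nl ->]]|_ [n [_ ln ->]]|_ _ [n [bn nl ->]] [n' [nb' ln' ->]]|] :=
    @int_separate Q P u v.
- rewrite ltNge; apply/negP => un.
  by have /s_eq0P/(_ _ (lexx _)) := vu _ un; rewrite aspVK; lia.
- by have /s_eq0P/(_ _ ln) := vv _ (lexx _).
- by apply: red; lia.
move=> a [Qa Pa]; exists a; apply: s_mul_split => n ? ?.
  by apply: Qa; exists n.
by apply: Pa; exists n.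
Qed.

(** Put [b := delta^-1 x]; let [l] be a maximizer for [(x + 1, b)] and [l'] one for
[(y, b)]. As [s delta _ b] jumps at [x], all maximizers for [(x + 1, b)] are at
most [gamma^-1 x]. If [l' <= gamma^-1 y], then [s delta _ b] jumps at [y] too,
which means [b <= delta^-1 y]. Otherwise [l < l'], and by the Monge inequality [l']
would be a maximizer for [(x + 1, b)] as well, although it exceeds [gamma^-1 x]. *)
Lemma is_tri_weak (gamma beta delta : ASP) (x y : int) :
    is_tri gamma beta delta -> x < y ->
    (gamma^-1)%g x < (gamma^-1)%g y -> (delta^-1)%g x < (delta^-1)%g y.
Proof.
move=> tri_d xy gxy; set b := (delta^-1)%g x; rewrite ltNge; apply/negP => dyx.
have yNb : (delta^-1)%g y <> b by move=> /asp_inj; lia.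
have [[l dl] _] := tri_d (x + 1) b; have [[l' dl'] max_y] := tri_d y b.
have [_ max_x] := tri_d x b; have [_ max_y1] := tri_d (y + 1) b.
have dx := s_succ delta x b; have dy := s_succ delta y b.
have gx := s_succ gamma x; have gy := s_succ gamma y.
have lx : l <= (gamma^-1)%g x.
  by rewrite leNgt; apply/negP => ?; have := max_x l; have := gx l; lia.
case: (leP l' ((gamma^-1)%g y)) => l'y.
  by have := max_y1 l'; have := gy l'; lia.
have ll' : l <= l' by lia.
have xy1 : x + 1 <= y by lia.
have := s_monge gamma xy1 ll'; have := max_y l; have := max_x l'.
by have := gx l'; lia.
Qed.

(** By residuation, [tri gamma beta^-1] is the least left factor whose star product
with [beta] is above [gamma]. *)
Lemma star_factor (alpha beta gamma : ASP) :
    le_chi gamma (star alpha beta) ->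
  let delta := tri gamma (beta^-1)%g in
  [/\ le_chi delta alpha, le_chi (delta^-1 * gamma)%g beta &
      Inv delta `&` Inv ((delta^-1 * gamma)^-1)%g = set0].
Proof.
move=> [gle gchi] delta.
have tri_d : is_tri gamma (beta^-1)%g delta := triP _ _.
have red : Inv delta `&` Inv ((delta^-1 * gamma)^-1)%g = set0.
  apply/reduced_pairP => u v uv.
  change (delta^-1%g (gamma v) < delta^-1%g (gamma u) ->
    delta (delta^-1%g (gamma v)) < delta (delta^-1%g (gamma u))).
  rewrite !aspKV => vu; rewrite ltNge le_eqVlt; apply/negP => /orP[/eqP|] uv'.
    by have := asp_inj uv'; lia.
  by have := is_tri_weak tri_d uv'; rewrite !aspVK => /(_ uv); lia.
have prodE : (delta * (delta^-1 * gamma))%g = gamma by rewrite mulVKg.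
have chi_d : chi delta = chi alpha.
  by rewrite chi_tri chiV gchi (chi_is_star (starP alpha beta)); lia.
split=> //; split=> //.
- move=> a l; have [[b] + _] := tri_d a l; rewrite invgK.
  by have := gle a b; have [_ /(_ l)] := starP alpha beta a b; lia.
- move=> l b; have [a] := reduced_attained l b red; rewrite prodE.
  by have [_ /(_ b)] := tri_d a l; rewrite invgK; lia.
have := chi_is_star (is_star_reduced red); rewrite prodE gchi.
by rewrite (chi_is_star (starP alpha beta)); lia.
Qed.

(** * Reduced tuples *)

Lemma reduced_cons (a : ASP) (t : seq ASP) :
  reduced (a :: t) <->
  Inv a `&` Inv ((\prod_(b <- t) b)^-1)%g = set0 /\ reduced t.
Proof.
split=> [red|[red0 red] [|n]]; [|by rewrite /= drop0|exact: red].
by split=> [|n nt]; [have := red 0%N isT; rewrite /= drop0|exact: (red n.+1)].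
Qed.

Lemma Inv1 : Inv 1%g = set0.
Proof. by apply/seteqP; split=> // -[p q] [/= pq]; rewrite ltNge ltW. Qed.

Lemma reduced_seq1 (b : ASP) : reduced [:: b].
Proof. by apply/reduced_cons; rewrite big_nil invg1 Inv1 setI0. Qed.

(** A pair of integers inverted by [b] is not inverted back by the whole product of
[t]; as [t] is reduced, it is not inverted back at any intermediate stage
either. *)
Lemma reduced_rcons (t : seq ASP) (b : ASP) :
    reduced t -> Inv (\prod_(a <- t) a)%g `&` Inv (b^-1)%g = set0 ->
  reduced (rcons t b).
Proof.
elim: t => [_ _|a t IH]; first exact: reduced_seq1.
move=> /reduced_cons[/reduced_pairP + redt] /reduced_pairP.
rewrite big_cons; set p := (\prod_(c <- t) c)%g in IH * => reda redb.
apply/reduced_cons; split.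
  apply/reduced_pairP; rewrite big_rcons /= -/p => u v uv pvu.
  case: (ltgtP (b v) (b u)) => [vu|uv'|/asp_inj]; last by lia.
    exact: redb uv vu.
  exact: reda uv' pvu.
apply: IH => //; apply/reduced_pairP => u v uv vu.
have apvu : a (p (b v)) < a (p (b u)) := redb _ _ uv vu.
case: (ltgtP (p (b v)) (p (b u))) => // [uv'|/asp_inj]; last by lia.
by have := reda _ _ vu uv'; lia.
Qed.

Lemma star_prod_rcons (t : seq ASP) (a : ASP) : t != [::] ->
  star_prod (rcons t a) = star (star_prod t) a.
Proof. by case: t => // b t _; rewrite /star_prod rcons_cons foldl_rcons. Qed.

Lemma tuple_factor (G : {pred ASP}) (G_group : group_closed G)
    (G_tri : forall alpha beta, alpha \in G -> beta \in G -> tri alpha beta \in G)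
    (t : seq ASP) (gamma : ASP) :
    t != [::] -> {subset t <= G} -> gamma \in G -> le_chi gamma (star_prod t) ->
  exists u : seq ASP,
    [/\ size u = size t, reduced u,
        forall i, (i < size t)%N ->
          nth 1%g u i \in G /\ le_chi (nth 1%g u i) (nth 1%g t i),
        star_prod u = (\prod_(b <- u) b)%g &
        (\prod_(b <- u) b)%g = gamma].
Proof.
have [G1 GV] := G_group.
have GI : invg_closed G by move=> x Gx; rewrite -[_^-1%g]mul1g; apply: GV.
elim/last_ind: t gamma => // t alpha IH gamma _ tG gammaG.
have [-> gle|tN0] := eqVneq t [::].
  exists [:: gamma]; split=> //; last 1 first.
  - by rewrite big_seq1.
  - exact: reduced_seq1.
  - by case.
  by rewrite big_seq1.
rewrite star_prod_rcons // => /star_factor.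
set delta := tri _ _ => -[dle ble red].
have aG : alpha \in G by apply: tG; rewrite mem_rcons mem_head.
have dG : delta \in G by apply: G_tri => //; exact: GI.
have bG : (delta^-1 * gamma)%g \in G.
  by rewrite -[gamma]invgK; apply: GV; exact: GI.
have [|//|//|u [su ured ule ustar uprod]] := IH delta tN0.
  by move=> x xt; apply: tG; rewrite mem_rcons in_cons xt orbT.
exists (rcons u (delta^-1 * gamma)%g).
have uN0 : u != [::] by rewrite -size_eq0 su size_eq0.
have prodE : (\prod_(b <- rcons u (delta^-1 * gamma)%g) b)%g = gamma.
  by rewrite big_rcons /= uprod mulVKg.
rewrite star_prod_rcons // prodE; split=> //.
- by rewrite !size_rcons su.
- by apply: reduced_rcons; rewrite ?uprod.
- move=> i; rewrite size_rcons ltnS leq_eqVlt !nth_rcons su => /orP[/eqP->|it].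
    by rewrite ltnn eqxx.
  by rewrite it; exact: ule.
rewrite ustar uprod; apply: is_star_uniq (starP _ _) _.
by rewrite -[X in is_star _ _ X](mulVKg delta); exact: is_star_reduced.
Qed.

Theorem theorem6p5 (G : {pred ASP}) (G_group : group_closed G)
    (G_tri : forall alpha beta, alpha \in G -> beta \in G -> tri alpha beta \in G)
    (l : nat) (l_ge1 : (1 <= l)%N) (alpha : l.-tuple ASP) (gamma : ASP)
    (alphaG : forall i : 'I_l, tnth alpha i \in G) (gammaG : gamma \in G)
    (gamma_le : le_chi gamma (star_prod alpha)) :
  exists beta : l.-tuple ASP,
    reduced beta /\
    (forall i : 'I_l,
        tnth beta i \in G /\ le_chi (tnth beta i) (tnth alpha i)) /\
    star_prod beta = (\prod_(i < l) tnth beta i)%g /\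
    (\prod_(i < l) tnth beta i)%g = gamma.
Proof.
have alphaN0 : alpha != [::] :> seq ASP.
  by rewrite -size_eq0 size_tuple -lt0n.
have alphaS : {subset alpha <= G} by move=> _ /tnthP[i ->].
have [u [su ured ule ustar uprod]] :=
  tuple_factor G_group G_tri alphaN0 alphaS gammaG gamma_le.
have su' : size u == l by rewrite su size_tuple.
exists (Tuple su'); rewrite -(big_tuple _ _ (Tuple su') xpredT id) /=.
split=> //; split=> // i; rewrite !(tnth_nth 1%g); apply: ule.
by rewrite size_tuple.
Qed.
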